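(* There are absolute constants $c,C>0$ such that for every prime power $q$ and every integer $n\ge 2$, $$d_{TV}(L_q(f_n),L(\pi_n))\le C\exp\left(-c\max\{\sqrt{n\log n\log q},\,\log q\}\right).$$
   Context: $\log$ is the natural logarithm. $\pi_n$ is a uniformly random permutation in the symmetric group $S_n$, and $L(\pi)$ is the length of the longest cycle of $\pi$. $f_n=f_{n,q}$ is a uniformly random element of the set of monic polynomials of degree $n$ over the finite field $\mathbb{F}_q$, and $L_q(f)$ is the largest degree of an irreducible polynomial dividing $f$. The total variation distance is normalized here (without a factor $1/2$) as $$d_{TV}(L_q(f_n),L(\pi_n))=\sum_{m=1}^n\left|\mathbb{P}(L_q(f_n)=m)-\mathbb{P}(L(\pi_n)=m)\right|.$$ *)

(* Defs.v *)
From HB Require Import structures.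
From mathcomp Require Import all_boot all_order all_algebra all_fingroup.
From mathcomp Require Import all_classical all_reals all_analysis.

Set Implicit Arguments.
Unset Strict Implicit.
Unset Printing Implicit Defensive.

Import Order.TTheory GRing.Theory Num.Theory.

Local Open Scope ring_scope.

Definition unif_prob (R : realType) (T : finType) (A B : {set T}) : R :=
  #|A :&: B|%:R / #|A|%:R.

Definition longest_cycle (n : nat) (s : 'S_n) : nat :=
  \max_(c in porbits s) #|c|.

Definition monic_polys (F : finFieldType) (n : nat) : {set {poly_n.+1 F}} :=
  [set f : {poly_n.+1 F} | (polyn f \is monic) && (size (polyn f) == n.+1)].

(* Any divisor of f != 0 has size at most [size f], so the finite type
   [{poly_(size f) F}] contains all the divisors of f.  Recall that the degree
   of g is (size g).-1. *)
Definition largest_irr_degree (F : finFieldType) (f : {poly F}) : nat :=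
  \max_(g : {poly_(size f) F} | irreducibleb g && (polyn g %| f)%R)
     (size (polyn g)).-1.

(* P(L_q(f_n) = m), with f_n uniform over the monic polynomials of degree n. *)
Definition prob_Lq (R : realType) (F : finFieldType) (n m : nat) : R :=
  unif_prob R (monic_polys F n)
    [set f : {poly_n.+1 F} | largest_irr_degree (polyn f) == m].

(* P(L(pi_n) = m), with pi_n uniform over the symmetric group S_n. *)
Definition prob_L (R : realType) (n m : nat) : R :=
  unif_prob R [set: 'S_n] [set s : 'S_n | longest_cycle s == m].

(* Normalized without the factor 1/2. *)
Definition dTV_Lq_L (R : realType) (F : finFieldType) (n : nat) : R :=
  \sum_(1 <= m < n.+1) `|prob_Lq R F n m - prob_L R n m|.

(* Main.v *)
Require Import Defs.
From mathcomp Require Import all_boot all_order all_algebra all_fingroup.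
From mathcomp Require Import all_classical all_reals all_analysis.
From mathcomp Require Import fintype finset.
From mathcomp Require Import ring lra.

Import Order.TTheory GRing.Theory Num.Theory.

(** Fix m.  Let P(n) be the probability that a random permutation of n points
    has all its cycles of length at most m, and Q(n) the probability that a
    random monic polynomial of degree n has all its irreducible factors of
    degree at most m.  In generating functions,
      sum_n P(n) z^n = exp(sum_(j <= m) z^j / j),
      sum_n Q(n) z^n = exp(sum_j lambda_j z^j / j),
    where lambda_j is q^-j times the sum of deg p over the monic irreducible p
    of degree at most m whose degree divides j.  Without the restriction to
    degree at most m, lambda_j would be 1 for every j, because then Q = 1; so
    lambda_j = 1 for j <= m, while for j > m only the p of degree at most j / 2
    contribute and lambda_j <= 2 q^(-j/2).  Hence
      sum_n Q(n) z^n = (sum_n P(n) z^n) (sum_j h_j z^j)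
    with h_0 = 1, h_j = 0 for 0 < j <= m, and 0 <= h_j <= (j + 1) q^(-j/2), the
    last by comparison with (1 - q^(-1/2) z)^-2 = exp(2 sum_j q^(-j/2) z^j / j).
    So
      0 <= Q(n) - P(n) <= sum_(m < j <= n) (j + 1) q^(-j/2) P(n - j)
    (lemma [smooth_gap]), and the total variation distance is at most twice
    the sum over m of these differences.

    All generating functions are handled through the recursion that the
    logarithmic derivative provides: a = exp(sum_j w_j z^j / j) means
    n a_n = sum_(1 <= j <= n) w_j a_(n-j) (definition [exp_series]).  For
    permutations the recursion comes from conditioning on the cycle of a given
    point; for polynomials, from counting pairs (f, p^i) with p^i dividing f.

    It remains to bound q^(-j/2) P(n - j) for m < j <= n. If j >= n / 2, the
    first factor is at most q^(-n/4). Otherwise iterating the recursion for P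
    about n / (4 m) times gives P(n - j) <= (4 m / n)^floor(n / (4 m)). When m
    is less than n^(3/4) / 4, log (n / (4 m)) is at least (log n) / 4, and the
    two exponents n log n / m and m log q have sum at least a constant times
    sqrt(n log n log q) by the inequality of arithmetic and geometric means; for
    larger m the factor q^(-m/2) suffices. As j >= 2, the bound 1 / q holds in
    any case. The polynomial factor in n lost by summing over j and m is
    absorbed by halving the constant in the exponent. *)

Set Implicit Arguments.
Unset Strict Implicit.
Unset Printing Implicit Defensive.

Local Open Scope ring_scope.

(** * Permutations with short cycles *)

Section Permutations.
Local Open Scope nat_scope.
Implicit Type T : finType.

Definition smooth_perms T (m : nat) (A : {set T}) : {set {perm T}} :=
  [set s | perm_on A s && [forall x in A, #|porbit s x| <= m]].

Definition full_cycles T (x : T) (B : {set T}) : {set {perm T}} :=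
  [set s | perm_on B s && (porbit s x == B)].

(** Two permutations that agree on a set stable under one of them have the
    same orbits there; this compares a permutation with its restrictions. *)
Lemma porbit_agree T (B : {set T}) (s t : {perm T}) (x : T) :
    {in B, forall y, t y \in B} -> {in B, s =1 t} -> x \in B ->
  porbit s x = porbit t x.
Proof.
move=> tB st xB.
have E i : ((s ^+ i)%g x = (t ^+ i)%g x) /\ ((t ^+ i)%g x \in B).
  elim: i => [|i [E Bi]]; first by rewrite !expg0 perm1.
  by rewrite !expgSr !permM E st //; split => //; apply: tB.
apply/setP => y; apply/porbitP/porbitP => -[i ->]; exists i; first by rewrite (E i).1.
by rewrite (E i).1.
Qed.

Lemma perm_on_stable T (B : {set T}) (s : {perm T}) :
  perm_on B s -> {in B, forall y, s y \in B}.
Proof. by move=> sB y yB; rewrite (perm_closed _ sB). Qed.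

Lemma mul_perm_in T (B C : {set T}) (s t : {perm T}) :
    [disjoint B & C] -> perm_on B s -> perm_on C t ->
  {in B, (s * t)%g =1 s} /\ {in C, (s * t)%g =1 t}.
Proof.
move=> dBC sB tC; split=> y yA; rewrite permM.
  by rewrite (out_perm tC) // (disjointFr dBC) // perm_closed.
by rewrite (out_perm sB) // (disjointFl dBC).
Qed.

(** A permutation whose orbit through [x] is [B] stabilizes [B] and its
    complement, so it is the product of a full cycle on [B] and a permutation of
    the rest, with the same orbits. *)
Lemma smooth_fiber T (m : nat) (A B : {set T}) (x : T) :
    x \in B -> B \subset A -> #|B| <= m ->
  [set s in smooth_perms m A | porbit s x == B]
  = [set (s1 * s2)%g | s1 in full_cycles x B, s2 in smooth_perms m (A :\: B)].
Proof.
move=> xB sBA leBm.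
have dBD : [disjoint B & A :\: B].
  by rewrite -setI_eq0; apply/eqP/setP => y; rewrite !inE; case: (y \in B).
apply/setP => s; rewrite !inE; apply/idP/imset2P.
  case/andP=> /andP[sA /forall_inP sm] /eqP oB.
  have sB y : y \in B -> s y \in B.
    rewrite -oB => /porbitP[i ->]; rewrite -permM -expgSr; exact: mem_porbit.
  have nB : s \in 'N(B | 'P)%g.
    by apply/astabsP => y; apply/idP/idP => [|/sB//] /=; rewrite apermE -oB;
      rewrite -!eq_porbit_mem -(porbit_perm s 1 y) expg1.
  have rE := restr_permE nB.
  have rB := restr_perm_on B s.
  have rs y : y \in B -> porbit (restr_perm B s) y = porbit s y.
    by move=> yB; apply: (porbit_agree sB) => // z zB; exact: rE.
  have DE z : z \notin B -> ((restr_perm B s)^-1 * s)%g z = s z.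
    by move=> zB; rewrite permM (out_perm (perm_onV rB) zB).
  exists (restr_perm B s) ((restr_perm B s)^-1 * s)%g; rewrite ?mulKVg //.
    by rewrite inE rB rs // oB /=.
  rewrite inE; apply/andP; split.
    apply/subsetP => y; rewrite !inE /=; apply: contraR; rewrite negb_and negbK.
    case: (boolP (y \in B)) => [yB _|yB /= yA].
      rewrite permM; set z := ((restr_perm B s)^-1)%g y.
      have zB : z \in B by rewrite /z (perm_closed _ (perm_onV rB)).
      by rewrite -(rE z zB) /z permKV.
    by rewrite DE // (out_perm sA).
  apply/forall_inP => y /setDP[yA yB].
  rewrite (@porbit_agree _ (~: B) _ s) ?sm ?inE //.
    move=> z; rewrite !inE; apply: contra => szB.
    by move: (astabs_act z nB) => /=; rewrite apermE szB => <-.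
  by move=> z; rewrite inE => /DE.
case=> s1 s2; rewrite !inE => /andP[s1B /eqP o1] /andP[s2D /forall_inP sm] ->.
have [E1 E2] := mul_perm_in dBD s1B s2D.
have p1 y : y \in B -> porbit (s1 * s2)%g y = porbit s1 y.
  by move=> yB; apply: (porbit_agree (perm_on_stable s1B)).
have p2 y : y \in A :\: B -> porbit (s1 * s2)%g y = porbit s2 y.
  by move=> yD; apply: (porbit_agree (perm_on_stable s2D)).
rewrite p1 // o1 eqxx andbT; apply/andP; split.
  apply: perm_onM; first by apply: (subset_trans s1B).
  by apply: (subset_trans s2D); apply: subsetDl.
apply/forall_inP => y yA; case: (boolP (y \in B)) => yB; last first.
  by rewrite p2 ?inE ?yB // sm // inE yB.
have : y \in porbit s1 x by rewrite o1.
by rewrite p1 // -eq_porbit_mem => /eqP ->; rewrite o1.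
Qed.

Lemma card_smooth_fiber T (m : nat) (A B : {set T}) (x : T) :
    x \in B -> B \subset A -> #|B| <= m ->
  #|[set s in smooth_perms m A | porbit s x == B]|
  = #|full_cycles x B| * #|smooth_perms m (A :\: B)|.
Proof.
move=> xB sBA leBm; rewrite smooth_fiber //.
have dBD : [disjoint B & A :\: B].
  by rewrite -setI_eq0; apply/eqP/setP => y; rewrite !inE; case: (y \in B).
rewrite curry_imset2X card_in_imset ?cardsX // => -[s1 s2] [t1 t2].
rewrite !inE /= => /andP[/andP[s1B _] /andP[s2D _]].
move=> /andP[/andP[t1B _] /andP[t2D _]] E.
have [s1E s2E] := mul_perm_in dBD s1B s2D.
have [t1E t2E] := mul_perm_in dBD t1B t2D.
have E1 : s1 = t1.
  apply/permP => y; case: (boolP (y \in B)) => yB.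
    by rewrite -s1E // -t1E // E.
  by rewrite !(@out_perm _ B).
by move: E; rewrite E1 => /mulgI ->.
Qed.

Lemma porbit_sub T (A : {set T}) (s : {perm T}) (x : T) :
  perm_on A s -> x \in A -> porbit s x \subset A.
Proof.
move=> sA xA; apply/subsetP => y /porbitP[i ->]; elim: i => [|i IH].
  by rewrite expg0 perm1.
by rewrite expgSr permM (perm_closed _ sA).
Qed.

Lemma smooth_perms_split T (m : nat) (A : {set T}) (x : T) : x \in A ->
  #|smooth_perms m A| =
  \sum_(B : {set T} | [&& x \in B, B \subset A & #|B| <= m])
     #|full_cycles x B| * #|smooth_perms m (A :\: B)|.
Proof.
move=> xA.
rewrite -sum1_card.
rewrite (partition_big (fun s : {perm T} => porbit s x)
   (fun B : {set T} => [&& x \in B, B \subset A & #|B| <= m])) /=; last first.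
  move=> s; rewrite inE => /andP[sA /forall_inP sm].
  by rewrite porbit_id porbit_sub //= sm.
apply: eq_bigr => B /and3P[xB sBA leBm].
by rewrite -card_smooth_fiber // -sum1_card; apply: eq_bigl => s; rewrite !inE.
Qed.

(** The subsets of [A] of cardinal [k.+1] that contain [x] are the sets [x |:
    B'] with [B'] a subset of [A :\ x] of cardinal [k]. *)
Lemma sum_pointed_subsets T (m : nat) (A : {set T}) (x : T) (G : nat -> nat) :
    x \in A ->
  \sum_(B : {set T} | [&& x \in B, B \subset A & #|B| <= m]) G #|B| =
  \sum_(k < #|A| | k < m) 'C(#|A|.-1, k) * G k.+1.
Proof.
move=> xA.
have [n An] : exists n, #|A| = n.+1.
  by exists #|A :\ x|; rewrite (cardsD1 x A) xA.
have cA : #|A :\ x| = n by move: An; rewrite (cardsD1 x A) xA => -[].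
rewrite An /=.
rewrite (reindex_onto (fun B' : {set T} => x |: B') (fun B => B :\ x)) /=; last first.
  by move=> B /and3P[xB _ _]; rewrite setD1K.
rewrite (eq_bigl (fun B' : {set T} => (B' \subset A :\ x) && (#|B'| < m))); last first.
  move=> B' /=; rewrite setU11 subUset sub1set xA /= subsetD1.
  have -> : ((x |: B') :\ x == B') = (x \notin B').
    apply/eqP/idP => [<-|/setU1K //]; by rewrite !inE eqxx.
  case: (boolP (x \in B')) => xB'; rewrite ?andbF ?andbT //.
  by rewrite cardsU1 xB' add1n.
rewrite (partition_big (fun B' : {set T} => inord #|B'| : 'I_n.+1)
           (fun k : 'I_n.+1 => k < m)) /=; last first.
  by move=> B' /andP[sB lB]; rewrite inordK // ltnS -cA subset_leq_card.
apply: eq_bigr => k km.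
have -> : 'C(n, k) = 'C(#|A :\ x|, k) by rewrite cA.
rewrite -cards_draws -sum1_card big_distrl /=.
rewrite (eq_bigl (fun B' : {set T} =>
    B' \in [set B : {set T} | (B \subset A :\ x) & #|B| == k])); last first.
  move=> B'; rewrite inE; case sB: (B' \subset A :\ x) => //=.
  have lt : #|B'| < n.+1 by rewrite ltnS -cA subset_leq_card.
  apply/andP/eqP => [[_ /eqP/(congr1 val)]|E]; first by rewrite /= inordK.
  by rewrite E; split=> //; apply/eqP/val_inj; rewrite /= inordK // -E.
apply: eq_bigr => B'; rewrite inE => /andP[sB /eqP Ek].
rewrite mul1n cardsU1 Ek.
by move: sB; rewrite subsetD1 => /andP[_ ->]; rewrite add1n.
Qed.

Lemma smooth_perms_all T (A : {set T}) : #|smooth_perms #|T| A| = (#|A|)`!.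
Proof.
rewrite -card_perm -[RHS]cardsE; apply: eq_card => s; rewrite !inE.
have -> : [forall x in A, #|porbit s x| <= #|T|].
  by apply/forall_inP => x _; exact: max_card.
by rewrite andbT.
Qed.

(** The value follows by induction on [#|B|] from the decomposition of all the
    [(#|B|)`!] permutations of [B] by the orbit of [x]: for [0 < k < #|B|] the
    orbits of size [k] account for [(#|B|.-1)`!] of them, and the same number is
    left for the orbit [B]. *)
Lemma card_full_cycles T (B : {set T}) (x : T) :
  x \in B -> #|full_cycles x B| = (#|B|.-1)`!.
Proof.
move: {2}#|B| (leqnn #|B|) => n; elim: n B => [|n IH] B leBn xB.
  by move: leBn; rewrite leqn0 cards_eq0 => /eqP E; rewrite E inE in xB.
have B0 : 0 < #|B| by rewrite card_gt0; apply/set0Pn; exists x.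
have := smooth_perms_split #|T| xB; rewrite smooth_perms_all.
have H0 : [&& x \in B, B \subset B & #|B| <= #|T|] by rewrite xB subxx max_card.
rewrite (bigD1 B) //= setDv smooth_perms_all cards0 muln1.
rewrite (eq_bigr (fun C : {set T} => (#|C|.-1)`! * (#|B| - #|C|)`!)); last first.
  move=> C /andP[/and3P[xC sC _] nC].
  have ltC : #|C| < #|B| by apply: proper_card; rewrite properEneq nC.
  have leC : #|C| <= n by rewrite -ltnS; exact: leq_trans ltC leBn.
  by rewrite (IH C leC xC) smooth_perms_all cardsD (setIidPr sC).
have := sum_pointed_subsets #|T| (fun k => k.-1`! * (#|B| - k)`!) xB.
have -> : \sum_(k < #|B| | k < #|T|)
    'C(#|B|.-1, k) * (k.+1.-1`! * (#|B| - k.+1)`!) = (#|B|)`!.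
  rewrite (eq_bigl predT) => [|k]; last by rewrite (leq_trans (ltn_ord k)) ?max_card.
  rewrite (eq_bigr (fun=> (#|B|.-1)`!)) => [|k _].
    by rewrite sum_nat_const card_ord -{1}(prednK B0) -[in RHS](prednK B0) factS.
  have kB : k <= #|B|.-1 by rewrite -ltnS prednK.
  by rewrite -[RHS](bin_fact kB) -predn_sub -subnS.
rewrite (bigD1 B) //= subnn muln1.
by move=> <- /addIn ->.
Qed.

Lemma card_smooth_perms_rec T (m : nat) (A : {set T}) (c : nat -> nat) :
    0 < #|A| ->
    (forall B : {set T}, #|B| < #|A| -> #|smooth_perms m B| = c #|B|) ->
  #|smooth_perms m A| =
  \sum_(k < #|A| | k < m) 'C(#|A|.-1, k) * (k`! * c (#|A| - k.+1)).
Proof.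
move=> A0 IH; have [x xA] : exists x, x \in A by apply/set0Pn; rewrite -card_gt0.
rewrite (smooth_perms_split _ xA).
rewrite -(sum_pointed_subsets m (fun k => k.-1`! * c (#|A| - k)) xA).
apply: eq_bigr => B /and3P[xB sB _].
have B0 : 0 < #|B| by rewrite card_gt0; apply/set0Pn; exists x.
have cD : #|A :\: B| = #|A| - #|B| by rewrite cardsD (setIidPr sB).
by rewrite card_full_cycles // IH cD // -{2}[#|A|]subn0 ltn_sub2l.
Qed.

(** The recursion determines the count from [#|A|] alone, which spares
    transporting permutations along a bijection between [A] and an ordinal. *)
Lemma card_smooth_permsE T (m : nat) (A : {set T}) :
  #|smooth_perms m A| = #|smooth_perms m [set: 'I_#|A|]|.
Proof.
suff H n : forall (T' : finType) (B : {set T'}), #|B| = n ->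
    #|smooth_perms m B| = #|smooth_perms m [set: 'I_n]|.
  exact: H.
elim/ltn_ind: n => n IH T' B cB.
have [n0|n0] := posnP n.
  move: cB; rewrite n0 => /eqP; rewrite cards_eq0 => /eqP ->.
  have -> : [set: 'I_0] = set0 by apply/setP => -[].
  have E U : #|smooth_perms m (set0 : {set U})| = 1.
    rewrite -(cards1 (1%g : {perm U})); apply: eq_card => s; rewrite !inE.
    apply/andP/eqP => [[sn _]|->].
      by apply: (perm_on_id sn); rewrite cards0.
    by rewrite perm_on1; split=> //; apply/forall_inP => y; rewrite inE.
  by rewrite !E.
pose c k := #|smooth_perms m [set: 'I_k]|.
have R (U : finType) (C : {set U}) : #|C| = n -> #|smooth_perms m C| =
    \sum_(k < n | k < m) 'C(n.-1, k) * (k`! * c (n - k.+1)).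
  move=> cC; rewrite (@card_smooth_perms_rec _ _ _ c) cC //.
  by move=> D ltD; exact: IH.
by rewrite (R _ _ cB) (R _ [set: 'I_n]) // cardsT card_ord.
Qed.

Lemma smooth_perms_rec (m n : nat) : 0 < n ->
  #|smooth_perms m [set: 'I_n]| =
  \sum_(k < n | k < m)
     'C(n.-1, k) * (k`! * #|smooth_perms m [set: 'I_(n - k.+1)]|).
Proof.
move=> n0.
rewrite (@card_smooth_perms_rec _ _ _ (fun k => #|smooth_perms m [set: 'I_k]|));
  first by rewrite cardsT card_ord.
  by rewrite cardsT card_ord.
move=> B _; exact: card_smooth_permsE.
Qed.

Lemma longest_cycle_leq (m n : nat) (s : 'S_n) :
  (longest_cycle s <= m) = (s \in smooth_perms m [set: 'I_n]).
Proof.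
rewrite inE.
have -> : perm_on [set: 'I_n] s by apply/subsetP => y _; rewrite inE.
apply/bigmax_leqP/forall_inP => /= [H x _|H B /imsetP[x _ ->]].
  by apply: H; apply: imset_f.
by apply: H; rewrite inE.
Qed.

End Permutations.

(** * Polynomials with factors of small degree *)

Section Polynomials.
Variable F : finFieldType.
Implicit Types (f g p : {poly F}) (m d : nat).

Lemma irreducible_factor f :
  (1 < size f)%N -> exists2 p, irreducible_poly p & p \is monic /\ p %| f.
Proof.
move: {2}(size f) (leqnn (size f)) => k; elim: k f => [|k IH] f.
  by rewrite leqn0 => /eqP ->.
move=> lek f1; have f0 : f != 0 by rewrite -size_poly_gt0 ltnW.
have [fI|fN] := boolP (irreducibleb f).
  have lf0 : (lead_coef f)^-1 != 0 by rewrite invr_eq0 lead_coef_eq0.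
  exists ((lead_coef f)^-1 *: f); last first.
    split; last by rewrite dvdpZl.
    by rewrite monicE lead_coefZ mulVf // lead_coef_eq0.
  have [_ fi] := elimT (irreducibleP _) fI.
  split=> [|q q1]; first by rewrite size_scale.
  rewrite dvdpZr // => /(fi q q1); move/eqp_trans; apply.
  by rewrite eqp_sym eqp_scale.
have : exists q : {poly F}, [/\ size q != 1%N, q %| f & ~~ (q %= f)].
  apply: contrapT => /forallNP H; move/negP: fN; apply; apply/irreducibleP.
  split=> // q q1 qf; apply/negPn/negP => qN; exact: (H q).
case=> q [q1 qf qN].
have q0 : q != 0 by apply: contraTneq qf => ->; rewrite dvd0p.
have ltq : (size q < size f)%N.
  by rewrite ltn_neqAle dvdp_leq // andbT dvdp_size_eqp.
have [||p pI [pM pq]] := IH q.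
- by rewrite -ltnS; exact: leq_trans ltq lek.
- by rewrite ltn_neqAle eq_sym q1 size_poly_gt0.
by exists p => //; split=> //; exact: dvdp_trans qf.
Qed.

Lemma largest_irr_degreeP m f : f != 0 ->
  reflect (forall p, irreducible_poly p -> p %| f -> (size p <= m.+1)%N)
          (largest_irr_degree f <= m)%N.
Proof.
move=> f0; apply: (iffP idP) => [/bigmax_leqP H p pI pf|H].

  have sp := dvdp_leq f0 pf.
  have := H (NPoly sp) => /=; rewrite pf andbT => /(_ (introT (irreducibleP _) pI)).
  by rewrite -ltnS; case: (size p).
apply/bigmax_leqP => p /andP[pI pf]; have := H _ (elimT (irreducibleP _) pI) pf.
by case: (size p).
Qed.

(** An irreducible divisor of [p ^+ j * g] divides [p] or [g]. *)
Lemma largest_irr_degree_mulX m p g j :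
    irreducible_poly p -> (size p <= m.+1)%N -> g != 0 ->
  (largest_irr_degree (p ^+ j * g) <= m)%N = (largest_irr_degree g <= m)%N.
Proof.
move=> pI pm g0; have p0 := irredp_neq0 pI.
have pg0 : p ^+ j * g != 0 by rewrite mulf_neq0 // expf_neq0.
apply/(largest_irr_degreeP _ pg0)/(largest_irr_degreeP _ g0) => H q qI qd.
  by apply: H => //; rewrite dvdp_mull.
have [qp|qNp] := boolP (q %| p); first by rewrite (leq_trans (dvdp_leq p0 qp)).
apply: H => //; rewrite -(Gauss_dvdpr _ (q := p ^+ j)) //.
by rewrite coprimep_expr // irreducible_poly_coprime.
Qed.

Variable N : nat.
Local Notation V := {poly_N.+1 F}.

(** One ambient type, of the polynomials of degree at most [N], holds the
    polynomials of all degrees [d <= N], so that products and cofactors stay in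
    it. *)
Definition monic_deg d : {set V} :=
  [set f : V | (polyn f \is monic) && (size (polyn f) == d.+1)].

Definition smooth_polys m d : {set V} :=
  [set f in monic_deg d | (largest_irr_degree (polyn f) <= m)%N].

Definition monic_irr : {set V} :=
  [set p : V | irreducibleb (polyn p) && (polyn p \is monic)].

Definition degp f := (size f).-1.

(** The sum of [deg p * v_p f] over the primes [p], where the valuation [v_p f]
    is obtained by counting the powers of [p] that divide [f]. The bound [N] on
    the exponents is harmless for [f] of degree at most [N]. *)
Definition prime_mass f : nat :=
  \sum_(p in monic_irr) \sum_(1 <= j < N.+1) degp (polyn p) * (polyn p ^+ j %| f)%R.

Lemma size_monic_exp_mul p g j : p \is monic -> g \is monic ->
  size (p ^+ j * g) = (j * degp p + size g)%N.
Proof.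
move=> pM gM; rewrite size_monicM ?monic_exp ?monic_neq0 //.
by rewrite [size (p ^+ j)]polySpred ?monic_neq0 ?monic_exp // size_exp mulnC.
Qed.

Lemma monic_irrP (p : V) : reflect
  [/\ irreducible_poly (polyn p), polyn p \is monic & (0 < degp (polyn p))%N]
  (p \in monic_irr).
Proof.
rewrite inE; apply: (iffP andP) => [[/irreducibleP pI pM]|[pI pM _]].
  by split=> //; have [] := pI; rewrite /degp; case: (size _) => [|[]].
by split=> //; apply/irreducibleP.
Qed.

(** Multiplying by [p] raises the valuation at [p] by one and leaves those at
    the other primes unchanged, by coprimality. *)
Lemma prime_massM (p : V) g : p \in monic_irr -> g \is monic ->
    (degp (polyn p) + degp g <= N)%N ->
  prime_mass (polyn p * g) = (degp (polyn p) + prime_mass g)%N.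
Proof.
move=> pI gM leN; have /monic_irrP[pirr pM p0] := pI.
rewrite /prime_mass (bigD1 p pI) [in RHS](bigD1 p pI) /= addnA; congr (_ + _)%N.
  set k := degp (polyn p).
  have -> : (\sum_(1 <= j < N.+1) k * (polyn p ^+ j %| polyn p * g)%R =
             \sum_(0 <= j < N) k * (polyn p ^+ j %| g)%R)%N.
    rewrite big_add1 /=; apply: eq_bigr => j _.
    by rewrite exprS dvdp_mul2l // irredp_neq0.
  transitivity (\sum_(0 <= j < N.+1) k * (polyn p ^+ j %| g)%R)%N.
    rewrite big_nat_recr //=; case: (boolP (_ ^+ N %| g)) => [pg|_]; last first.
      by rewrite muln0 addn0.
    have := dvdp_leq (monic_neq0 gM) pg.
    rewrite -[_ ^+ _]mulr1 size_monic_exp_mul ?monic1 // size_poly1 addn1.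
    have E : size g = (degp g).+1 by rewrite polySpred ?monic_neq0.
    rewrite E ltnS => Hle; exfalso.
    have := leq_trans Hle (leq_addl (degp (polyn p)) (degp g)).
    move: leN p0 Hle; rewrite -/k; clear; move=> H1 H2 H3 _.
    have : (N < N)%N.
      apply: leq_trans H1; rewrite -add1n leq_add //.
      by apply: leq_trans H3; rewrite leq_pmulr.
    by rewrite ltnn.
  by rewrite big_nat_recl //= expr0 dvd1p muln1 [in RHS]big_add1.
apply: eq_bigr => q /andP[/monic_irrP[qirr qM q0] qp].
apply: eq_bigr => j _; rewrite Gauss_dvdpr //.
apply: coprimep_expl; rewrite irreducible_poly_coprime //.
apply: contra qp => qdp; rewrite -val_eqE /= -eqp_monic //.
by apply: pirr.2 => //; rewrite neq_ltn qirr.1 orbT.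
Qed.

(** This is the degree of the prime factorization of [g], by induction on the
    degree of [g]. *)
Lemma prime_mass_monic g : g \is monic -> (degp g <= N)%N -> prime_mass g = degp g.
Proof.
move: {2}(degp g) (leqnn (degp g)) => k; elim: k g => [|k IH] g lek gM leN.
  have dg : degp g = 0%N by apply/eqP; rewrite -leqn0.
  rewrite dg /prime_mass big1 // => p /monic_irrP[pI pM p0].
  rewrite big_nat_cond big1 // => j; rewrite andbT => /andP[j0 _].
  case: (boolP (_ %| _)) => [pg|]; last by rewrite muln0.
  have := dvdp_leq (monic_neq0 gM) pg.
  rewrite -[_ ^+ _]mulr1 size_monic_exp_mul ?monic1 // size_poly1 addn1.
  rewrite (polySpred (monic_neq0 gM)) -/(degp g) dg ltnS leqn0 muln_eq0.
  by rewrite (gtn_eqF j0) (gtn_eqF p0).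
have [g1|g1] := leqP (size g) 1.
  by apply: IH => //; move: g1; rewrite /degp; case: (size g) => [|[]].
have [p pI [pM pg]] := irreducible_factor g1.
have sg := polySpred (monic_neq0 gM); rewrite -/(degp g) in sg.
have sp : (size p <= N.+1)%N.
  by rewrite (leq_trans (dvdp_leq (monic_neq0 gM) pg)) // sg ltnS.
pose P := NPoly sp : V.
have PI : P \in monic_irr by rewrite inE /= pM andbT; apply/irreducibleP.
have /monic_irrP[_ _ /= P0] := PI.
have [h Eg] : exists h, g = p * h by exists (g %/ p); rewrite mulrC divpK.
have hM : h \is monic by move: gM; rewrite Eg monicMl.
have Ed : degp g = (degp p + degp h)%N.
  have := size_monic_exp_mul 1 pM hM; rewrite expr1 -Eg sg mul1n.
  by rewrite (polySpred (monic_neq0 hM)) addnS => -[].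
have lth : (degp h < degp g)%N by rewrite Ed -add1n leq_add2r.
rewrite [in LHS]Eg (@prime_massM P h PI hM) /= -?Ed // IH ?Ed //.
  by rewrite -ltnS; exact: leq_trans lth lek.
by apply: leq_trans leN; rewrite Ed leq_addl.
Qed.

Lemma smooth_polysP m d (f : V) : reflect
  [/\ polyn f \is monic, size (polyn f) = d.+1
    & (largest_irr_degree (polyn f) <= m)%N] (f \in smooth_polys m d).
Proof.
rewrite !inE; apply: (iffP andP) => [[/andP[fM /eqP sf] L]|[fM sf L]]; first by [].
by rewrite fM sf eqxx.
Qed.

(** The multiples of [p ^+ j] among the smooth polynomials are the products
    [p ^+ j * g] with [g] smooth, when [p] itself is small enough. *)
Lemma card_smooth_multiples m d (p : V) j :
    p \in monic_irr -> (0 < j)%N -> (d <= N)%N ->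
  #|[set f in smooth_polys m d | polyn p ^+ j %| polyn f]| =
  if (degp (polyn p) <= m)%N && (j * degp (polyn p) <= d)%N
  then #|smooth_polys m (d - j * degp (polyn p))| else 0%N.
Proof.
move=> /monic_irrP[pI pM p0] j0 dN.
have sp := polySpred (monic_neq0 pM); rewrite -/(degp (polyn p)) in sp.
case: ifP => [/andP[pm jd]|/negbT]; last first.
  rewrite negb_and -!ltnNge => H; apply/eqP; rewrite cards_eq0; apply/eqP/setP => f.
  rewrite in_set0; apply/negbTE/negP; rewrite inE => /andP[/smooth_polysP[fM sf L] pf].
  have f0 := monic_neq0 fM.
  have pf1 : polyn p %| polyn f by apply: dvdp_trans pf; apply: dvdp_exp.
  have := elimT (largest_irr_degreeP _ f0) L _ pI pf1.
  have := dvdp_leq f0 pf.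
  rewrite -[_ ^+ _]mulr1 size_monic_exp_mul ?monic1 // size_poly1 addn1 sf sp !ltnS.
  by move=> H1 H2; case/orP: H; rewrite ltnNge ?H1 ?H2.
have key (g : V) : g \in smooth_polys m (d - j * degp (polyn p)) ->
    polyn (npolyp N.+1 (polyn p ^+ j * polyn g)) = polyn p ^+ j * polyn g.
  case/smooth_polysP => gM sg _; apply: npolypK.
  by rewrite size_monic_exp_mul // sg addnS ltnS subnKC.
have <- : #|[set npolyp N.+1 (polyn p ^+ j * polyn g) |
    g in smooth_polys m (d - j * degp (polyn p))]| =
    #|smooth_polys m (d - j * degp (polyn p))|.
  apply: card_in_imset => g h gS hS /(congr1 (@polyn F N.+1)); rewrite !key // => E.
  by apply/val_inj/(mulfI _ E); rewrite expf_neq0 // irredp_neq0.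
apply: eq_card => f; rewrite inE; apply/andP/imsetP => [[]|[g gS ->]].
  case/smooth_polysP => fM sf L pf; set q := polyn p ^+ j in pf *.
  have [h Ef] : exists h, polyn f = q * h by exists (polyn f %/ q); rewrite mulrC divpK.
  have qM : q \is monic by rewrite monic_exp.
  have hM : h \is monic by move: fM; rewrite Ef monicMl.
  have sh : size h = (d - j * degp (polyn p)).+1.
    move: sf; rewrite Ef size_monic_exp_mul // => sf.
    by rewrite -subSn // -sf addKn.
  have hN : (size h <= N.+1)%N.
    by rewrite sh ltnS (leq_trans (leq_subr _ _)).
  have hS : (NPoly hN : V) \in smooth_polys m (d - j * degp (polyn p)).
    apply/smooth_polysP; split=> //=.
    by move: L; rewrite Ef /q largest_irr_degree_mulX ?sp ?monic_neq0.
  exists (NPoly hN : V) => //.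
  by apply/val_inj; rewrite [RHS](key _ hS) /= -Ef.
have /smooth_polysP[gM sg L] := gS.
rewrite key // dvdp_mulr //; split=> //; apply/smooth_polysP; rewrite key //; split.
- by rewrite monicMl ?monic_exp.
- by rewrite size_monic_exp_mul // sg addnS subnKC.
- by rewrite largest_irr_degree_mulX ?sp ?monic_neq0.
Qed.

(** The sum over the monic polynomials of degree [e] of the von Mangoldt
    function, which is [deg p] at the powers of a prime [p] and [0] elsewhere,
    restricted to the primes of degree at most [m]. *)
Definition von_mangoldt m (e : nat) : nat :=
  \sum_(p in monic_irr | (degp (polyn p) <= m)%N)
    \sum_(1 <= j < N.+1) degp (polyn p) * (j * degp (polyn p) == e).

(** Both sides count, with weight [deg p], the pairs of a smooth polynomial [f]
    of degree [d] and a prime power [p ^+ j] that divides [f]. *)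
Lemma smooth_polys_rec m d : (d <= N)%N ->
  (d * #|smooth_polys m d| =
   \sum_(1 <= e < d.+1) von_mangoldt m e * #|smooth_polys m (d - e)|)%N.
Proof.
move=> dN.
transitivity (\sum_(f in smooth_polys m d) prime_mass (polyn f))%N.
  rewrite mulnC -sum_nat_const; apply: eq_bigr => f /smooth_polysP[fM sf _].
  by rewrite prime_mass_monic // /degp sf.
rewrite exchange_big /=.
under [RHS]eq_bigr do rewrite big_distrl /=.
rewrite [RHS]exchange_big /= [RHS]big_mkcondr /=; apply: eq_bigr => p pI.
rewrite exchange_big /=.
under [X in if _ then X else _]eq_bigr do rewrite big_distrl /=.
rewrite [X in if _ then X else _]exchange_big /=.
set k := degp (polyn p).
transitivity (\sum_(1 <= j < N.+1) k *
  (if (k <= m) && (j * k <= d) then #|smooth_polys m (d - j * k)| else 0))%N.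
  rewrite !big_nat; apply: eq_bigr => j /andP[j0 _].
  rewrite -big_distrr /= -(card_smooth_multiples _ pI) //; congr (_ * _)%N.
  rewrite -sum1_card [RHS](eq_bigl (fun f : V =>
    (f \in smooth_polys m d) && (polyn p ^+ j %| polyn f))); last first.
    by move=> f; rewrite inE.
  by rewrite [RHS]big_mkcondr /=; apply: eq_bigr => f _; case: (_ %| _).
case: (leqP k m) => km /=; last by rewrite big1 // => j _; rewrite muln0.
rewrite !big_nat; apply: eq_bigr => j /andP[j0 _].
under eq_bigr do rewrite -mulnA.
rewrite -big_distrr /=; congr (_ * _)%N.
case: ifP => jkd.
  rewrite (bigD1_seq (j * k)%N) ?iota_uniq //=; last first.
    rewrite mem_index_iota ltnS jkd andbT muln_gt0 j0.
    by have /monic_irrP[_ _] := pI.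
  rewrite eqxx mul1n big1 ?addn0 // => e; rewrite eq_sym => /negbTE ->.
  by rewrite mul0n.
rewrite big_nat big1 // => e /andP[_]; rewrite ltnS => ed.
case: eqP => [E|_]; last by rewrite mul0n.
by rewrite E ed in jkd.
Qed.

End Polynomials.

(** * Prime powers of given degree *)

Section VonMangoldt.
Variables (F : finFieldType) (N : nat).
Local Notation V := {poly_N.+1 F}.
Local Open Scope nat_scope.
Implicit Types m d e : nat.

(** Subtracting the leading monomial leaves an arbitrary polynomial of size at
    most [d]. *)
Lemma card_monic_deg d : d <= N -> #|monic_deg F N d| = #|F| ^ d.
Proof.
move=> dN.
rewrite -card_npoly -[RHS]cardsT.
have sE (g : {poly_d F}) : size ('X^d + polyn g : {poly F})%R = d.+1.
  by rewrite size_polyDl size_polyXn // ltnS size_npoly.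
pose emb (g : {poly_d F}) : V := npolyp N.+1 ('X^d + polyn g)%R.
have E (g : {poly_d F}) : polyn (emb g) = ('X^d + polyn g)%R.
  by apply: npolypK; rewrite sE.
have <- : #|[set emb g | g in [set: {poly_d F}]]| = #|[set: {poly_d F}]|.
  apply: card_imset => g h /(congr1 (@polyn F N.+1)); rewrite !E => /addrI.
  exact: val_inj.
apply: eq_card => f; rewrite inE; apply/andP/imsetP => [[fM /eqP sf]|[g _ ->]].
  have sg : size (polyn f - 'X^d : {poly F})%R <= d.
    apply/leq_sizeP => j; rewrite leq_eqVlt coefB coefXn => /predU1P[<-|dj].
      by move: fM; rewrite monicE lead_coefE sf /= => /eqP ->; rewrite eqxx subrr.
    by rewrite (gtn_eqF dj) subr0 nth_default // sf.
  exists (NPoly sg); first by rewrite inE.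
  by apply/val_inj; rewrite /= E /= addrC subrK.
rewrite E sE eqxx; split=> //; rewrite monicE lead_coefE sE /= coefD coefXn eqxx.
by rewrite nth_default ?addr0 // size_npoly.
Qed.

Lemma largest_irr_degree_le (f : {poly F}) : largest_irr_degree f <= degp f.
Proof.
apply/bigmax_leqP => p _; rewrite /degp.
by have := size_npoly p; case: (size f) (size _) => [|k] [|l].
Qed.

Lemma smooth_polys_all m d : d <= m -> smooth_polys F N m d = monic_deg F N d.
Proof.
move=> dm; apply/setP => f; rewrite !inE.
case: eqP => [sf|]; last by rewrite andbF.
rewrite andbT; apply/andb_idr => _.
by rewrite (leq_trans (largest_irr_degree_le _)) // /degp sf.
Qed.

(** With no restriction on the primes, [smooth_polys_rec] reads [e * q ^ e =
    \sum_(1 <= k < e.+1) von_mangoldt k * q ^ (e - k)], which determines the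
    values by induction: the terms with [k < e] add up to [e.-1 * q ^ e]. *)
Lemma von_mangoldt_full e : 0 < e <= N -> von_mangoldt F N N e = #|F| ^ e.
Proof.
elim/ltn_ind: e => e IH /andP[e0 eN].
have q0 : 0 < #|F| by apply/card_gt0P; exists 0%R.
have := @smooth_polys_rec F N N e eN.
rewrite smooth_polys_all // card_monic_deg // big_nat_recr //= subnn.
rewrite smooth_polys_all // card_monic_deg // expn0 muln1.
rewrite big_nat (eq_bigr (fun=> #|F| ^ e)); last first.
  move=> k /andP[k0 ke]; rewrite IH ?k0 ?(leq_trans (ltnW ke)) //.
  rewrite smooth_polys_all ?(leq_trans (leq_subr _ _)) //.
  rewrite card_monic_deg ?(leq_trans (leq_subr _ _)) //.
  by rewrite -expnD subnKC // ltnW.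
rewrite -big_nat sum_nat_const_nat.
by case: e e0 {IH eN} => // e _; rewrite subn1 /= mulSn addnC => /addnI ->.
Qed.

Lemma von_mangoldt_small m e : e <= m ->
  0 < e -> von_mangoldt F N m e = von_mangoldt F N N e.
Proof.
move=> em e0; rewrite /von_mangoldt !big_mkcondr; apply: eq_bigr => p pI.
have pN : degp (polyn p) <= N.
  by rewrite /degp; have := size_npoly p; case: (size _).
rewrite pN; case: leqP => // mp; apply/esym.
rewrite big_nat big1 // => j /andP[j0 _].
case: eqP => [E|_]; last by rewrite muln0.
suff : e < e by rewrite ltnn.
rewrite -{2}E; apply: (leq_ltn_trans em); apply: (leq_trans mp).
by rewrite leq_pmull.
Qed.

Lemma sum_expn_le q h : 1 < q -> \sum_(1 <= k < h.+1) q ^ k <= 2 * q ^ h.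
Proof.
move=> q1; elim: h => [|h IH]; first by rewrite big_geq.
rewrite big_nat_recr //= (leq_trans (leq_add IH (leqnn _))) //.
by rewrite [leqRHS]mul2n -addnn leq_add2r expnS leq_mul2r q1 orbT.
Qed.

(** A prime of degree [k <= m < e] with a power of degree [e] has [k <= e./2],
    and the primes of degree [k] have total degree at most
    [von_mangoldt F N N k = #|F| ^ k]. *)
Lemma von_mangoldt_large m e : m < e -> e <= N ->
  von_mangoldt F N m e <= 2 * #|F| ^ e./2.
Proof.
move=> me eN.
have q1 : 1 < #|F|.
  by apply/card_gt1P; exists 0%R, 1%R; split=> //; rewrite eq_sym oner_eq0.
apply: leq_trans (sum_expn_le _ q1).
have -> : \sum_(1 <= k < e./2.+1) #|F| ^ k =
    \sum_(1 <= k < e./2.+1) von_mangoldt F N N k.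
  rewrite !big_nat; apply: eq_bigr => k /andP[k0 ke].
  rewrite von_mangoldt_full // k0 /=; apply: leq_trans eN.
  apply: (@leq_trans e./2) => //.
  by rewrite -{2}(odd_double_half e) -addnn addnA leq_addl.
rewrite /von_mangoldt [leqRHS]exchange_big /= big_mkcondr /= [leqRHS]big_mkcondr /=.
apply: leq_sum => p pI; have /monic_irrP[_ _ p0] := pI.
set k := degp (polyn p) in p0 *.
have kN : k <= N by rewrite /k /degp; have := size_npoly p; case: (size _).
rewrite kN; case: (leqP k m) => // km.
have [/hasP[j]|H] := boolP (has (fun j => j * k == e) (index_iota 1 N.+1)); last first.
  rewrite big_seq big1 // => j jI; case: eqP => [E|_]; last by rewrite muln0.
  by move/hasPn: H => /(_ _ jI); rewrite E eqxx.
move=> jI /eqP Ej.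
rewrite (bigD1_seq j) ?iota_uniq //= Ej eqxx muln1 big1 ?addn0; last first.
  move=> i ij; case: eqP => [E|_]; last by rewrite muln0.
  by case/eqP: ij; apply/eqP; rewrite -(eqn_pmul2r p0) E Ej.
have j2 : 1 < j.
  rewrite ltn_neqAle; apply/andP; split; last first.
    by move: jI; rewrite mem_index_iota => /andP[].
  apply/eqP => j1; move: me; rewrite -Ej -j1 mul1n ltnNge.
  by rewrite km.
have k2 : k <= e./2.
  rewrite -Ej geq_half_double -mul2n.
  by rewrite leq_mul2r j2 orbT.
rewrite (bigD1_seq k) ?iota_uniq //= ?mem_index_iota ?p0 ?ltnS ?k2 //.
apply: leq_trans (leq_addr _ _).
rewrite big_nat_recl //; last by apply: leq_trans p0 kN.
by rewrite mul1n eqxx muln1 leq_addr.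
Qed.

End VonMangoldt.

(** * Exponentials of power series *)

Section Sequences.
Variable R : realType.
Implicit Types (a b c u v w h : nat -> R) (n m N : nat).

Definition conv a b n : R := \sum_(j < n.+1) a j * b (n - j)%N.

Lemma conv_coef N a b n : (n <= N)%N ->
  ((\poly_(i < N.+1) a i) * (\poly_(i < N.+1) b i))`_n = conv a b n.
Proof.
move=> nN; rewrite coefM; apply: eq_bigr => j _; rewrite !coef_poly !ltnS.
by rewrite (leq_trans (leq_ord j) nN) (leq_trans (leq_subr _ _) nN).
Qed.

Lemma convC a b n : conv a b n = conv b a n.
Proof. by rewrite -!(conv_coef _ _ (leqnn n)) mulrC. Qed.

Lemma eq_conv a1 a2 b1 b2 n :
    (forall i, (i <= n)%N -> a1 i = a2 i) -> (forall i, (i <= n)%N -> b1 i = b2 i) ->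
  conv a1 b1 n = conv a2 b2 n.
Proof.
move=> Ea Eb; apply: eq_bigr => i _; rewrite Ea; last exact: leq_ord.
by rewrite Eb ?leq_subr.
Qed.

Lemma convA a b c n : conv a (conv b c) n = conv (conv a b) c n.
Proof.
pose P (x : nat -> R) := \poly_(i < n.+1) x i.
have E x y : forall i, (i <= n)%N -> conv x y i = (P x * P y)`_i.
  by move=> i ni; rewrite conv_coef.
have PP (x : nat -> R) (p : {poly R}) : (forall i, (i <= n)%N -> x i = p`_i) ->
    forall y, conv x y n = (p * P y)`_n /\ conv y x n = (P y * p)`_n.
  move=> H y; rewrite !coefM; split; apply: eq_bigr => j _; rewrite !coef_poly !ltnS.
    by rewrite H ?leq_ord // leq_subr.
  by rewrite H ?leq_subr // leq_ord.
rewrite (PP _ _ (E b c) a).2 (PP _ _ (E a b) c).1.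
by rewrite mulrA.
Qed.

(** [a] agrees up to order [N] with the coefficients of the exponential of
    [\sum_(j > 0) (w j / j) z^j]; this is the coefficientwise form of the
    differential equation [z A' = W A], [A 0 = 1]. *)
Definition exp_series N w a : Prop :=
  a 0%N = 1 /\ forall n, (n <= N)%N ->
    n%:R * a n = \sum_(1 <= j < n.+1) w j * a (n - j)%N.

(** Removing the constant coefficient turns the sum in [exp_series] into a
    convolution. *)
Definition no_const w : nat -> R := fun j => if j == 0%N then 0 else w j.

Lemma conv_no_const w a n :
  conv (no_const w) a n = \sum_(1 <= j < n.+1) w j * a (n - j)%N.
Proof.
rewrite /conv -(big_mkord xpredT (fun j => no_const w j * a (n - j)%N)).
rewrite big_nat_recl //= /no_const eqxx mul0r add0r big_add1 /=.
by [].
Qed.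

Lemma exp_series_uniq N w a b : exp_series N w a -> exp_series N w b ->
  forall n, (n <= N)%N -> a n = b n.
Proof.
move=> [a0 aE] [b0 bE]; elim/ltn_ind => -[_ _|n IH nN]; first by rewrite a0 b0.
have n0 : (n.+1%:R : R) != 0 by rewrite pnatr_eq0.
apply: (mulfI n0); rewrite aE // bE // !big_nat; apply: eq_bigr => j /andP[j0 jn].
rewrite IH ?(leq_trans (leq_subr _ _)) //.
by rewrite ltn_subrL j0.
Qed.

(** The product of the exponentials of two series is the exponential of their
    sum, by the Leibniz rule for [z d/dz]. *)
Lemma exp_series_conv N u v a b : exp_series N u a -> exp_series N v b ->
  exp_series N (fun j => u j + v j) (conv a b).
Proof.
move=> [a0 aE] [b0 bE]; split; first by rewrite /conv big_ord1 a0 b0 mulr1.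
move=> n nN; rewrite -conv_no_const.
have Eu : conv (no_const u) (conv a b) n = \sum_(j < n.+1) j%:R * a j * b (n - j)%N.
  rewrite convA; apply: eq_bigr => j _.
  by rewrite conv_no_const -aE // (leq_trans (leq_ord j)).
have Ev : conv (no_const v) (conv a b) n =
    \sum_(j < n.+1) a j * ((n - j)%:R * b (n - j)%N).
  rewrite convA (eq_conv (a2 := conv a (no_const v)) (b2 := b)) //; last first.
    by move=> i _; exact: convC.
  rewrite -convA; apply: eq_bigr => j _.
  by rewrite conv_no_const -bE // (leq_trans (leq_subr _ _)).
transitivity (conv (no_const u) (conv a b) n + conv (no_const v) (conv a b) n).
  rewrite Eu Ev /conv -big_split /= big_distrr /=; apply: eq_bigr => j _.
  by rewrite natrB ?leq_ord //; ring.
rewrite /conv -big_split; apply: eq_bigr => j _ /=.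
by rewrite -mulrDl /no_const; case: eqP; rewrite ?addr0.
Qed.

Lemma exp_series_exists N w : exists h, exp_series N w h.
Proof.
elim: N => [|N [h [h0 hE]]].
  exists (fun=> 1); split=> // n; rewrite leqn0 => /eqP ->.
  by rewrite mul0r big_geq.
exists (fun n => if (n <= N)%N then h n
  else (N.+1%:R)^-1 * \sum_(1 <= j < N.+2) w j * h (N.+1 - j)%N).
split=> // n; rewrite leq_eqVlt => /predU1P[->|].
  rewrite ltnn mulrA divff ?pnatr_eq0 // mul1r !big_nat.
  by apply: eq_bigr => -[//|j] _; rewrite subSS leq_subr.
rewrite ltnS => nN; rewrite nN hE //; apply: eq_bigr => j _.
by rewrite (leq_trans (leq_subr _ _)).
Qed.

(** The upper bound is the coefficient of [(1 - y z)^-2], the exponential of the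
    series with weights [2 * y ^+ j]. *)
Lemma exp_series_le N w h (y : R) : exp_series N w h -> 0 <= y ->
    (forall j, (0 < j <= N)%N -> 0 <= w j <= 2 * y ^+ j) ->
  forall n, (n <= N)%N -> 0 <= h n <= n.+1%:R * y ^+ n.
Proof.
move=> [h0 hE] y0 wE; elim/ltn_ind => -[_ _|n IH nN].
  by rewrite h0 expr0 mulr1 lexx ler01.
have n0 : (0 : R) < n.+1%:R by rewrite ltr0n.
have B j : (1 <= j < n.+2)%N -> 0 <= w j * h (n.+1 - j)%N <=
    2 * y ^+ n.+1 * (n.+2 - j)%:R.
  move=> /andP[j0 jn]; have /andP[w0 w1] : 0 <= w j <= 2 * y ^+ j.
    by rewrite wE // j0 (leq_trans _ nN).
  have /andP[k0 k1] := IH (n.+1 - j)%N ltac:(by rewrite ltn_subrL j0)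
    ltac:(by rewrite (leq_trans (leq_subr _ _))).
  rewrite mulr_ge0 //= (le_trans (ler_pM w0 k0 w1 k1)) //.
  have -> : y ^+ n.+1 = y ^+ j * y ^+ (n.+1 - j) by rewrite -exprD subnKC.
  by rewrite (@subSn j n.+1 jn) le_eqVlt; apply/orP; left; apply/eqP; ring.
apply/andP; split.
  by rewrite -(pmulr_rge0 _ n0) hE // big_nat sumr_ge0 // => j /B /andP[].
rewrite -(ler_pM2l n0) hE //.
apply: le_trans (_ : \sum_(1 <= j < n.+2) 2 * y ^+ n.+1 * (n.+2 - j)%:R <= _).
  by rewrite !big_nat; apply: ler_sum => j /B /andP[].
rewrite -mulr_sumr -natr_sum big_nat_rev /=.
rewrite (_ : \sum_(1 <= j < n.+2) _ = \sum_(1 <= j < n.+2) j)%N; last first.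
  rewrite !big_nat; apply: eq_bigr => j /andP[j0 jn].
  by rewrite add1n subSS subKn; last exact: ltnW.
have -> : (\sum_(1 <= j < n.+2) j = 'C(n.+2, 2))%N.
  by rewrite -triangular_sum [RHS]big_ltn // add0n.
have E : (2 * 'C(n.+2, 2)%:R = n.+2%:R * n.+1%:R :> R).
  by rewrite -!natrM mulnC muln2 bin2 -[X in (X./2.*2)%N]/(n.+2 * n.+1)%N
    even_halfK // oddM /= negbK andbN.
by rewrite mulrAC E le_eqVlt; apply/orP; left; apply/eqP; ring.
Qed.

(** Since [lam] and the weights of [P] agree up to [m], the quotient of the two
    exponentials is the exponential [h] of the part of [lam] beyond [m]. It
    starts [1 + 0 z + ... + 0 z^m], so [Q - P] only involves its coefficients
    beyond [m]. *)
Lemma smooth_gap N m (y : R) (P Q lam : nat -> R) :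
    0 <= y ->
    exp_series N (fun j => (j <= m)%:R) P -> exp_series N lam Q ->
    (forall j, (0 < j <= N)%N -> (j <= m)%N -> lam j = 1) ->
    (forall j, (0 < j <= N)%N -> (m < j)%N -> 0 <= lam j <= 2 * y ^+ j) ->
    (forall n, (n <= N)%N -> 0 <= P n) ->
  `|Q N - P N| <= \sum_(m.+1 <= j < N.+1) j.+1%:R * y ^+ j * P (N - j)%N.
Proof.
move=> y0 PE QE lam1 lam2 P0.
pose w j := if (j <= m)%N then 0 else lam j.
have [h hE] := exp_series_exists N w.
have hP := exp_series_conv hE PE.
have Qh : Q N = conv h P N.
  apply: (exp_series_uniq QE _ (leqnn N)); split; first by case: hP.
  move=> n nN; case: hP => _ ->//; rewrite !big_nat; apply: eq_bigr => j.
  rewrite ltnS => /andP[j0 jn]; congr (_ * _); rewrite /w.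
  by case: leqP => jm; rewrite ?add0r ?addr0 // lam1 // j0 (leq_trans jn).
have hB := exp_series_le hE y0.
have {}hB n : (n <= N)%N -> 0 <= h n <= n.+1%:R * y ^+ n.
  apply: hB => j jN; rewrite /w; case: leqP => jm; last exact: lam2.
  by rewrite lexx /= mulr_ge0 // exprn_ge0.
have hz n : (0 < n <= m)%N -> (n <= N)%N -> h n = 0.
  case: hE => _ hE; case/andP=> n0 nm nN.
  have nz : (n%:R : R) != 0 by rewrite pnatr_eq0 -lt0n.
  apply: (mulfI nz); rewrite hE // mulr0 big_nat big1 // => j /andP[j0 jn].
  by rewrite /w (leq_trans _ nm) ?mul0r.
have h0 : h 0%N = 1 by case: hE.
have -> : Q N - P N = \sum_(m.+1 <= j < N.+1) h j * P (N - j)%N.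
  rewrite Qh /conv -(big_mkord xpredT (fun j => h j * P (N - j)%N)).
  rewrite big_nat_recl //= h0 mul1r subn0 addrC addKr.
  rewrite -(big_add1 _ _ _ N.+1 xpredT (fun j => h j * P (N - j)%N)).
  have [mN|Nm] := leqP m N; last first.
    rewrite [RHS]big_geq; last by rewrite ltnS ltnW.
    rewrite big_nat big1 // => j /andP[j0 jN].
    by rewrite hz ?mul0r // j0 -ltnS (leq_trans jN) // ltnW.
  rewrite (big_cat_nat (n := m.+1)) //= big_nat big1 ?add0r // => j /andP[j0 jm].
  by rewrite hz ?mul0r ?j0 // (leq_trans _ mN).
rewrite ger0_norm.
  rewrite !big_nat; apply: ler_sum => j /andP[jm jN].
  by apply: ler_wpM2r; [rewrite P0 // leq_subr|have /andP[] := hB j jN].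
rewrite big_nat; apply: sumr_ge0 => j /andP[jm jN].
by apply: mulr_ge0; [have /andP[] := hB j jN|rewrite P0 // leq_subr].
Qed.

Lemma exp_series_indic_le1 N m P : exp_series N (fun j => (j <= m)%:R) P ->
  forall n, (n <= N)%N -> 0 <= P n <= 1.
Proof.
move=> [P0 PE]; elim/ltn_ind => -[_ _|n IH nN]; first by rewrite P0 ler01 lexx.
have n0 : (0 : R) < n.+1%:R by rewrite ltr0n.
have B j : (1 <= j < n.+2)%N -> 0 <= (j <= m)%:R * P (n.+1 - j)%N <= 1.
  move=> /andP[j0 jn].
  have := IH (n.+1 - j)%N ltac:(by rewrite ltn_subrL j0)
    ltac:(by rewrite (leq_trans (leq_subr _ _))).
  by case: (j <= m)%N; rewrite ?mul1r // mul0r lexx ler01.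
apply/andP; split.
  by rewrite -(pmulr_rge0 _ n0) PE // big_nat sumr_ge0 // => j /B /andP[].
rewrite -(ler_pM2l n0) PE // mulr1.
apply: le_trans (_ : \sum_(1 <= j < n.+2) 1 <= _).
  by rewrite !big_nat; apply: ler_sum => j /B /andP[].
by rewrite sumr_const_nat subn1.
Qed.

(** Each use of the recursion at some [n'] with [4 * n' >= n] bounds [P n'] by
    [m / n' <= 4 * m / n] times the largest of the [m] preceding values; the
    hypothesis on [t] lets this be repeated [t] times before the index falls
    below [n / 4]. *)
Lemma exp_series_indic_decay N m P (n t n' : nat) :
    exp_series N (fun j => (j <= m)%:R) P -> (0 < n)%N ->
    (n' <= N)%N -> (n + 4 * m * t <= 4 * n')%N ->
  P n' <= ((4 * m)%:R / n%:R) ^+ t.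
Proof.
move=> PE n0; have P1 := exp_series_indic_le1 PE.
elim: t n' => [|t IH] n' n'N le; first by rewrite expr0; case/andP: (P1 _ n'N).
have n'0 : (0 < n')%N.
  by rewrite -(ltn_pmul2l (m := 4)) // muln0 (leq_trans _ le) // addn_gt0 n0.
have mn' : (m <= n')%N.
  rewrite -(leq_pmul2l (m := 4)) // (leq_trans _ le) // mulnS.
  by rewrite addnCA leq_addr.
have r0 : (0 : R) <= ((4 * m)%:R / n%:R) ^+ t.
  by rewrite exprn_ge0 // divr_ge0 // ler0n.
have n'R : (0 : R) < n'%:R by rewrite ltr0n.
case: PE => _ PE.
have : n'%:R * P n' <= m%:R * ((4 * m)%:R / n%:R) ^+ t.
  rewrite PE // (big_cat_nat (n := m.+1)) //=.
  rewrite [X in _ + X]big_nat [X in _ + X]big1 ?addr0; last first.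
    by move=> j /andP[mj _]; rewrite leqNgt mj mul0r.
  have -> : m%:R * ((4 * m)%:R / n%:R) ^+ t =
      \sum_(1 <= j < m.+1) ((4 * m)%:R / n%:R : R) ^+ t.
    by rewrite sumr_const_nat subn1 mulr_natl.
  rewrite !big_nat; apply: ler_sum => j /andP[j0]; rewrite ltnS => jm.
  rewrite jm mul1r; apply: IH; first by rewrite (leq_trans (leq_subr _ _)).
  rewrite mulnBr leq_subRL; last by rewrite leq_mul2l (leq_trans jm mn').
  rewrite (leq_trans _ le) // mulnS addnCA leq_add2l leq_add2r.
  by rewrite leq_mul2l.
rewrite -ler_pdivlMl // => /le_trans; apply.
rewrite exprS mulrA; apply: ler_wpM2r => //.
rewrite mulrC ler_pdivrMr // mulrAC ler_pdivlMr ?ltr0n //.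
rewrite -!natrM ler_nat (mulnC 4) -mulnA leq_mul2l.
by rewrite (leq_trans _ le) ?leq_addr ?orbT.
Qed.

End Sequences.

(** * Distribution functions of the two largest parts *)

Section Cumulative.
Variable R : realType.

Definition cdf_L (m n : nat) : R := #|smooth_perms m [set: 'I_n]|%:R / n`!%:R.

(** [N] is the degree bound of the ambient type of polynomials, [n] the degree
    of the random polynomial. *)
Definition cdf_Lq (F : finFieldType) (N m n : nat) : R :=
  #|smooth_polys F N m n|%:R / #|F|%:R ^+ n.

Lemma cdf_L_exp_series N m : exp_series N (fun j => (j <= m)%:R) (cdf_L m).
Proof.
split=> [|n _].
  rewrite /cdf_L fact0 divr1; apply/eqP; rewrite pnatr_eq1; apply/eqP.
  rewrite -[RHS](cards1 (1%g : 'S_0)); apply: eq_card => s; rewrite !inE.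
  have -> : s = 1%g by apply/permP => -[].
  by rewrite eqxx perm_on1; apply/forall_inP => -[].
have [->|n0] := posnP n; first by rewrite mul0r big_geq.
have fn0 k : (k`!%:R : R) != 0 by rewrite pnatr_eq0 -lt0n fact_gt0.
rewrite big_add1 /= big_mkord {1}/cdf_L smooth_perms_rec // natr_sum mulrA mulr_sumr.
rewrite mulr_suml big_mkcond /=; apply: eq_bigr => k _.
case: ltnP => km; last by rewrite mul0r.
rewrite mul1r /cdf_L.
have kn : (k <= n.-1)%N by rewrite -ltnS prednK.
have E : (n`!%:R = n%:R * ('C(n.-1, k)%:R * (k`!%:R * (n - k.+1)`!%:R)) :> R).
  rewrite -!natrM -{1}(prednK n0) factS prednK // -(bin_fact kn).
  by rewrite -subn1 -subnDA add1n.
rewrite !natrM E; field.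
rewrite !fn0 ?pnatr_eq0 -?lt0n ?n0 ?bin_gt0 ?kn //.
Qed.

Section Poly.
Variables (F : finFieldType) (N : nat).

Lemma card_field_gt1 : (1 < #|F|)%N.
Proof. by apply/card_gt1P; exists 0%R, 1%R; split=> //; rewrite eq_sym oner_eq0. Qed.

Lemma cdf_Lq_exp_series m :
  exp_series N (fun e => (von_mangoldt F N m e)%:R / #|F|%:R ^+ e) (cdf_Lq F N m).
Proof.
have q0 : (#|F|%:R : R) != 0 by rewrite pnatr_eq0 -lt0n ltnW // card_field_gt1.
split=> [|n nN].
  by rewrite /cdf_Lq smooth_polys_all // card_monic_deg // expn0 expr0 divr1.
rewrite /cdf_Lq mulrA -natrM smooth_polys_rec // natr_sum mulr_suml !big_nat.
apply: eq_bigr => e /andP[e0 en].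
have -> : (#|F|%:R ^+ n : R) = #|F|%:R ^+ e * #|F|%:R ^+ (n - e).
  by rewrite -exprD subnKC.
by rewrite natrM; field; rewrite !expf_neq0.
Qed.

Lemma von_mangoldt_density_small m e : (0 < e <= N)%N -> (e <= m)%N ->
  (von_mangoldt F N m e)%:R / #|F|%:R ^+ e = 1 :> R.
Proof.
move=> /andP[e0 eN] em.
rewrite von_mangoldt_small // von_mangoldt_full ?e0 // natrX divff // expf_neq0 //.
by rewrite pnatr_eq0 -lt0n ltnW // card_field_gt1.
Qed.

Lemma expR_half_ln : expR (- ln #|F|%:R / 2) ^+ 2 = (#|F|%:R : R)^-1.
Proof.
have q0 : (0 : R) < #|F|%:R by rewrite ltr0n ltnW // card_field_gt1.
rewrite -expRM_natl mulrC divfK ?pnatr_eq0 //.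
by rewrite expRN lnK.
Qed.

Lemma von_mangoldt_density_large m e : (0 < e <= N)%N -> (m < e)%N ->
  0 <= ((von_mangoldt F N m e)%:R / #|F|%:R ^+ e : R)
    <= 2 * expR (- ln (#|F|%:R : R) / 2) ^+ e.
Proof.
move=> /andP[e0 eN] me.
have q1 : (1 : R) <= #|F|%:R by rewrite ler1n ltnW // card_field_gt1.
have q0 : (0 : R) < #|F|%:R by apply: lt_le_trans q1.
rewrite divr_ge0 ?exprn_ge0 ?ler0n //= ler_pdivrMr ?exprn_gt0 //.
apply: le_trans (_ : 2 * #|F|%:R ^+ e./2 <= _).
  by rewrite -natrX -natrM ler_nat von_mangoldt_large.
rewrite -mulrA ler_pM2l //.
set y := expR _; have y0 : 0 < y by rewrite expR_gt0.
set q := #|F|%:R in q0 q1 *.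
have yq : y ^+ 2 * q = 1 by rewrite expR_half_ln mulVf // gt_eqF.
have y1 : 1 <= y * q.
  rewrite -[X in _ * X](lnK q0) -expRD; apply: le_trans (expR_ge1Dx _).
  by have := ln_ge0 q1; rewrite -/q; lra.
have E : (y * q) ^+ 2 = q by rewrite exprMn [q ^+ 2]expr2 mulrA yq mul1r.
have -> : y ^+ e * q ^+ e = (y * q) ^+ odd e * q ^+ e./2.
  rewrite -exprMn -{1}(odd_double_half e) exprD -mul2n.
  by rewrite exprM E.
by rewrite ler_peMl ?exprn_ge0 ?(ltW q0) // exprn_ege1.
Qed.

Lemma prob_Lq_cdf m : (0 < m)%N ->
  prob_Lq R F N m = cdf_Lq F N m N - cdf_Lq F N m.-1 N.
Proof.
move=> m0; rewrite /prob_Lq /unif_prob.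
have cM : #|monic_polys F N| = (#|F| ^ N)%N by rewrite -(@card_monic_deg F N N).
rewrite cM natrX /cdf_Lq -mulrBl; congr (_ / _).
have S1 : smooth_polys F N m.-1 N \subset smooth_polys F N m N.
  apply/subsetP => f /smooth_polysP[? ? L]; apply/smooth_polysP; split=> //.
  by rewrite (leq_trans L) // leq_pred.
rewrite -natrB ?subset_leq_card //; congr (_%:R).
rewrite -(setIidPr S1) -cardsD; apply: eq_card => f; rewrite !inE.
have -> : (largest_irr_degree (polyn f) == m) =
    ~~ (largest_irr_degree (polyn f) <= m.-1)%N &&
    (largest_irr_degree (polyn f) <= m)%N.
  by rewrite eqn_leq -ltnNge prednK // andbC.
by case: (polyn f \is monic); case: (size (polyn f) == N.+1).
Qed.

End Poly.

Lemma prob_L_cdf n m : (0 < m)%N -> prob_L R n m = cdf_L m n - cdf_L m.-1 n.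
Proof.
move=> m0; rewrite /prob_L /unif_prob cardsT card_Sn /cdf_L -mulrBl; congr (_ / _).
set A := smooth_perms m _; set B := smooth_perms m.-1 _.
have S1 : B \subset A.
  apply/subsetP => s; rewrite -!longest_cycle_leq => L.
  by rewrite (leq_trans L) // leq_pred.
rewrite -natrB ?subset_leq_card //; congr (_%:R).
rewrite -(setIidPr S1) -cardsD; apply: eq_card => s.
rewrite in_setD /A /B -!longest_cycle_leq !inE /= eqn_leq -ltnNge prednK //.
by rewrite andbC.
Qed.

Lemma exp_series_zero N w (a : nat -> R) n : exp_series N w a ->
  (forall j, (0 < j)%N -> w j = 0) -> (0 < n <= N)%N -> a n = 0.
Proof.
move=> [_ aE] w0 /andP[n0 nN]; have nz : (n%:R : R) != 0 by rewrite pnatr_eq0 -lt0n.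
apply: (mulfI nz); rewrite aE // mulr0 big_nat big1 // => j /andP[j0 _].
by rewrite w0 ?mul0r.
Qed.

Definition cdf_gap (F : finFieldType) (m n : nat) : R :=
  `|cdf_Lq F n m n - cdf_L m n|.

Lemma cdf_gap0 F n : (0 < n)%N -> cdf_gap F 0 n = 0.
Proof.
move=> n0; rewrite /cdf_gap.
rewrite (exp_series_zero (cdf_L_exp_series n 0)) ?n0 ?leqnn //; last by case.
rewrite (exp_series_zero (cdf_Lq_exp_series F n 0)) ?n0 ?leqnn ?subrr ?normr0 //.
move=> j _; rewrite /von_mangoldt big1 ?mul0r // => p /andP[/monic_irrP[_ _ p0]].
by rewrite leqNgt p0.
Qed.

(** A point probability is a difference of two consecutive values of the
    distribution function, so each value of [cdf_gap] is used at most twice. *)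
Lemma dTV_le_cdf_gap F n : (0 < n)%N ->
  dTV_Lq_L R F n <= 2 * \sum_(1 <= m < n.+1) cdf_gap F m n.
Proof.
move=> n0; rewrite /dTV_Lq_L.
apply: le_trans (_ : \sum_(1 <= m < n.+1) (cdf_gap F m n + cdf_gap F m.-1 n) <= _).
  rewrite !big_nat; apply: ler_sum => m /andP[m0 _].
  rewrite prob_Lq_cdf // prob_L_cdf // /cdf_gap.
  apply: le_trans (ler_normB _ _); rewrite le_eqVlt; apply/orP; left.
  by apply/eqP; congr (`| _ |); ring.
rewrite big_split /= mulr_natl mulr2n lerD2l big_add1 /=.
case: n n0 => // n n0; rewrite [leLHS]big_nat_recl // cdf_gap0 // add0r.
by rewrite [leRHS]big_nat_recr //= [leRHS]addrC big_add1 lerDr normr_ge0.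
Qed.

Lemma cdf_gap_le F m n :
  cdf_gap F m n <= \sum_(m.+1 <= j < n.+1)
    j.+1%:R * expR (- ln #|F|%:R / 2) ^+ j * cdf_L m (n - j).
Proof.
apply: smooth_gap.
- exact: expR_ge0.
- exact: cdf_L_exp_series.
- exact: cdf_Lq_exp_series.
- by move=> j jn jm; exact: von_mangoldt_density_small.
- by move=> j jn jm; exact: von_mangoldt_density_large.
- by move=> k _; rewrite /cdf_L divr_ge0.
Qed.

End Cumulative.

(** * Numerical estimates *)

Section Estimates.
Variable R : realType.
Implicit Types (k l X : R) (n m j : nat).

Lemma ln_ge_half n : (2 <= n)%N -> 1 / 2 <= ln (n%:R : R).
Proof.
move=> n2; have n0 : (0 : R) < n%:R by rewrite ltr0n (leq_trans _ n2).
have i0 : (0 : R) < n%:R^-1 by rewrite invr_gt0.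
have := @le_ln1Dx R (n%:R^-1 - 1) ltac:(by rewrite ltrBrDl subrr).
rewrite addrC subrK lnV ?posrE //.
have : n%:R^-1 <= 2^-1 :> R by rewrite lef_pV2 ?posrE ?ler_nat.
lra.
Qed.

Lemma ln_sqr_le n : (1 <= n)%N -> ln (n%:R : R) ^+ 2 <= 2 * n%:R.
Proof.
move=> n1; have n0 : (0 : R) < n%:R by rewrite ltr0n.
have l0 : 0 <= ln (n%:R : R) by rewrite ln_ge0 // ler1n.
have := expR_ge1Dxn 1 l0; rewrite lnK // !factS fact0 => H.
have : ln (n%:R : R) ^+ 2 / (2 * 1)%N%:R <= n%:R.
  by apply: le_trans H; rewrite lerDr.
by rewrite ler_pdivrMr ?ltr0n // mulrC.
Qed.

(** The term of index [j] in [smooth_gap]: [p] stands for [P (n - j)] and [y]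
    for [q^(-1/2)]. It is bounded by [q^-1] and by [exp(- X / 16)] with [X =
    sqrt(n log n log q)]. *)
Section Term.
Variables (q n m j : nat) (p y : R).
Hypotheses (q2 : (2 <= q)%N) (n2 : (2 <= n)%N) (m1 : (1 <= m)%N).
Hypotheses (mj : (m < j)%N) (jn : (j <= n)%N).
Hypothesis p1 : p <= 1.
Hypothesis pt : forall t, (n + 4 * m * t <= 4 * (n - j))%N ->
  p <= ((4 * m)%:R / n%:R) ^+ t.
Hypothesis yE : y = expR (- ln (q%:R) / 2).

Let l := ln (n%:R : R).
Let k := ln (q%:R : R).
Let X := Num.sqrt (n%:R * l * k).

Let l2 : 1 / 2 <= l. Proof. exact: ln_ge_half. Qed.
Let k2 : 1 / 2 <= k. Proof. exact: ln_ge_half. Qed.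
Let nR : (2 : R) <= n%:R. Proof. by rewrite ler_nat. Qed.
Let mR : (1 : R) <= m%:R. Proof. by rewrite ler1n. Qed.
Let facts : [/\ 1 / 2 <= l, 1 / 2 <= k, (2 : R) <= n%:R & (1 : R) <= m%:R].
Proof. by split; [exact: l2|exact: k2|exact: nR|exact: mR]. Qed.
Let nlk : 0 <= n%:R * l * k.
Proof. by have [hl hk hn hm] := facts; apply: mulr_ge0; [apply: mulr_ge0|]; lra. Qed.
Let X0 : 0 <= X. Proof. exact: sqrtr_ge0. Qed.
Let X2 : X ^+ 2 = n%:R * l * k. Proof. exact: sqr_sqrtr. Qed.
Let yj : y ^+ j = expR (- (j%:R * k / 2)).
Proof. by rewrite yE -expRM_natl; congr expR; rewrite /k; ring. Qed.

Lemma term_le_inv_q : p * y ^+ j <= expR (- k).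
Proof.
have [hl hk hn hm] := facts.
apply: le_trans (_ : y ^+ j <= _).
  by rewrite -[leRHS]mul1r ler_wpM2r // yE exprn_ge0 // expR_ge0.
rewrite yj ler_expR lerN2.
have : (2 : R) <= j%:R by rewrite ler_nat (leq_trans _ mj).
move=> j2; nra.
Qed.

Let Xle (b : R) : 0 <= b -> n%:R * l * k <= b ^+ 2 -> X <= b.
Proof.
by move=> b0; rewrite -X2 => H; rewrite -(@ler_pXn2r _ 2) ?nnegrE.
Qed.

Lemma term_le_j_large : (n <= 2 * j)%N -> p * y ^+ j <= expR (- X / 16).
Proof.
have [hl hk hn hm] := facts.
move=> nj.
apply: le_trans (_ : y ^+ j <= _).
  by rewrite -[leRHS]mul1r ler_wpM2r // yE exprn_ge0 // expR_ge0.
rewrite yj ler_expR.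
have njR : n%:R <= 2 * j%:R :> R by rewrite -natrM ler_nat.
have XB : X <= 2 * n%:R * k.
  apply: Xle; first by apply: mulr_ge0; lra.
  have ln : l <= n%:R by apply/ltW/ln_sublinear; lra.
  have -> : (2 * n%:R * k) ^+ 2 = n%:R * (4 * n%:R * k) * k by ring.
  apply: ler_wpM2r; first lra.
  apply: ler_wpM2l; first lra.
  nra.
nra.
Qed.

(** Here [m] is at least of order [n^(3/4)], so [m ^ 2] dominates [n log n]
    because [(log n) ^ 2 <= 2 n]; hence [m log q] alone dominates [X]. *)
Lemma term_le_m_large : (n ^ 3 <= 256 * m ^ 4)%N -> p * y ^+ j <= expR (- X / 16).
Proof.
have [hl hk hn hm] := facts.
move=> nm.
apply: le_trans (_ : y ^+ j <= _).
  by rewrite -[leRHS]mul1r ler_wpM2r // yE exprn_ge0 // expR_ge0.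
rewrite yj ler_expR.
have jR : m%:R <= j%:R :> R by rewrite ler_nat ltnW.
have nmR : n%:R ^+ 3 <= 256 * m%:R ^+ 4 :> R by rewrite -!natrX -natrM ler_nat.
have l2n : l ^+ 2 <= 2 * n%:R by apply: ln_sqr_le; exact: ltnW.
have nl : n%:R * l <= 32 * m%:R ^+ 2.
  have nl0 : 0 <= n%:R * l by apply: mulr_ge0; lra.
  have m20 : 0 <= 32 * m%:R ^+ 2 :> R by rewrite mulr_ge0 // exprn_ge0.
  rewrite -(@ler_pXn2r _ 2) ?nnegrE //.
  apply: le_trans (_ : 2 * n%:R ^+ 3 <= _).
    have -> : 2 * n%:R ^+ 3 = n%:R ^+ 2 * (2 * n%:R) :> R by ring.
    by rewrite exprMn ler_wpM2l // exprn_ge0.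
  have -> : (32 * m%:R ^+ 2) ^+ 2 = 1024 * m%:R ^+ 4 :> R by ring.
  have : 0 <= m%:R ^+ 4 :> R by rewrite exprn_ge0.
  lra.
have XB : X <= 8 * m%:R * k.
  apply: Xle; first by apply: mulr_ge0; lra.
  have -> : (8 * m%:R * k) ^+ 2 = (64 * m%:R ^+ 2 * k) * k by ring.
  apply: ler_wpM2r; first lra.
  apply: le_trans nl _.
  have : 0 <= m%:R ^+ 2 :> R by rewrite exprn_ge0.
  nra.
nra.
Qed.

(** With [v = n / (4 m)], the hypothesis on [m] gives [v ^+ 4 >= n], so that
    [log v >= (log n) / 4] and the decay of [p] contributes at least
    [n log n / (32 m)] to the exponent.  The sum of this and [m log q / 2] is
    at least twice their geometric mean, which is [X / 8]. *)
Lemma term_le_m_small : (256 * m ^ 4 < n ^ 3)%N -> (2 * j < n)%N ->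
  p * y ^+ j <= expR (- X / 16).
Proof.
have [hl hk hn hm] := facts.
move=> nm nj.
have m0 : (0 : R) < m%:R by lra.
have n0 : (0 : R) < n%:R by lra.
pose v : R := n%:R / (4 * m%:R).
have v0 : 0 < v by rewrite divr_gt0 // mulr_gt0.
have v4 : n%:R <= v ^+ 4.
  rewrite /v expr_div_n ler_pdivlMr; last by rewrite exprn_gt0 // mulr_gt0.
  have -> : n%:R * (4 * m%:R) ^+ 4 = n%:R * (256 * m%:R ^+ 4) :> R by ring.
  rewrite [leRHS]exprS ler_pM2l // -!natrX -natrM ler_nat; exact: ltnW.
have lv : l <= 4 * ln v.
  rewrite mulr_natl -lnXn // ler_ln ?posrE // exprn_gt0 //.
have v1 : 1 <= v.
  rewrite -(@ler_pXn2r _ 4) ?nnegrE ?(ltW v0) // expr1n; apply: le_trans v4; lra.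
have m4 : (0 < 4 * m)%N by rewrite muln_gt0.
pose t := (n %/ (4 * m))%N.
have tn : (4 * m * t <= n)%N by rewrite mulnC leq_trunc_div.
have t1 : (1 <= t)%N.
  rewrite divn_gt0 // -(ler_nat R) natrM.
  by move: v1; rewrite /v ler_pdivlMr ?mul1r // mulr_gt0.
(* [n < 4 * m * t.+1], and [t.+1 <= 2 * t] because [v >= 1]. *)
have nt : (n <= 8 * m * t)%N.
  apply: ltnW; apply: leq_trans (ltn_ceil n m4) _; rewrite -/t.
  have -> : (8 * m * t = (t + t) * (4 * m))%N.
    by rewrite -mulnA mulnDl addnn -mul2n [(t * _)%N]mulnC !mulnA.
  by rewrite leq_mul2r -[X in (X < _)%N]addn0 ltn_add2l t1 orbT.
have ntR : n%:R <= 8 * m%:R * t%:R :> R by rewrite -!natrM ler_nat.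
have pB : p <= expR (- (t%:R * ln v)).
  have -> : expR (- (t%:R * ln v)) = ((4 * m)%:R / n%:R) ^+ t.
    rewrite -mulrN expRM_natl; congr (_ ^+ _).
    by rewrite expRN lnK // /v invf_div natrM.
  apply: pt; rewrite mulnBr.
  rewrite leq_subRL ?leq_mul2l //.
  apply: (@leq_trans (4 * j + (n + n))%N); first by rewrite !leq_add2l.
  apply: (@leq_trans (2 * n + (n + n))%N).
    by rewrite leq_add2r -[4%N]/(2 * 2)%N -mulnA leq_mul2l ltnW.
  by rewrite addnn -mul2n -mulnDl.
rewrite yj.
apply: le_trans (_ : expR (- (t%:R * ln v)) * expR (- (j%:R * k / 2)) <= _).
  by rewrite ler_wpM2r // expR_ge0.
rewrite -expRD ler_expR.
have jR : m%:R <= j%:R :> R by rewrite ler_nat ltnW.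
have H1 : n%:R * l / (32 * m%:R) <= t%:R * ln v.
  rewrite ler_pdivrMr ?mulr_gt0 //.
  have t0 : (0 : R) <= t%:R by [].
  apply: le_trans (_ : 8 * m%:R * t%:R * (4 * ln v) <= _).
    by apply: ler_pM => //; lra.
  by rewrite le_eqVlt; apply/orP; left; apply/eqP; ring.
have H2 : m%:R * k / 2 <= j%:R * k / 2.
  by rewrite !ler_pM2r ?invr_gt0 //; lra.
have H3 : X / 4 <= n%:R * l / (32 * m%:R) + m%:R * k / 2.
  set a := n%:R * l / (32 * m%:R); set b := m%:R * k / 2.
  have a0 : 0 <= a by rewrite /a divr_ge0 ?mulr_ge0 //; lra.
  have b0 : 0 <= b by rewrite /b divr_ge0 ?mulr_ge0 //; lra.
  have ab : X ^+ 2 = 64 * (a * b).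
    by rewrite X2 /a /b; field; lra.
  rewrite ler_pdivrMr //.
  rewrite -(@ler_pXn2r _ 2) ?nnegrE //; last by rewrite mulr_ge0 // addr_ge0.
  rewrite ab.
  have : 0 <= (a - b) ^+ 2 by rewrite sqr_ge0.
  nra.
have := X0; lra.
Qed.

Lemma term_le : p * y ^+ j <= expR (- (Num.max X k) / 16).
Proof.
have [hl hk hn hm] := facts.
rewrite maxEle; case: ifP => _.
  apply: le_trans term_le_inv_q _; rewrite ler_expR; lra.
have [nj|nj] := leqP n (2 * j); first exact: term_le_j_large.
have [nm|nm] := leqP (n ^ 3) (256 * m ^ 4); first exact: term_le_m_large.
exact: term_le_m_small.
Qed.

End Term.
End Estimates.

(** There are at most [n] terms, each with a factor [j.+1 <= n.+1]. *)
Lemma cdf_gap_bound (R : realType) (F : finFieldType) (n m : nat) :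
    (2 <= n)%N -> (1 <= m)%N ->
  cdf_gap R F m n <= 2 * n%:R ^+ 2 *
    expR (- Num.max (Num.sqrt (n%:R * ln n%:R * ln #|F|%:R)) (ln #|F|%:R) / 16).
Proof.
move=> n2 m1; apply: le_trans (cdf_gap_le _ _ _ _) _.
set E := expR (- Num.max _ _ / 16).
have n0 : (0 < n)%N by exact: ltnW.
have E0 : 0 <= E by exact: expR_ge0.
have L := cdf_L_exp_series R n m.
apply: le_trans (_ : \sum_(m.+1 <= j < n.+1) n.+1%:R * E <= _).
  rewrite !big_nat; apply: ler_sum => j /andP[mj jn].
  have /andP[P0 P1] := exp_series_indic_le1 L (leq_subr j n).
  have T := term_le (card_field_gt1 F) n2 m1 mj jn P1
    (fun t => exp_series_indic_decay L n0 (leq_subr j n)) erefl.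
  rewrite -mulrA [X in _ * X]mulrC; apply: ler_pM => //.
  - by rewrite mulr_ge0 // exprn_ge0 // expR_ge0.
  - by rewrite ler_nat.
rewrite sumr_const_nat -[leLHS]mulr_natl mulrA ler_wpM2r //.
have : (n.+1 - m.+1)%:R <= n%:R :> R by rewrite ler_nat subSS leq_subr.
have : (1 : R) <= n%:R by rewrite ler1n.
rewrite -natr1; set a := (_ - _)%:R => n1 an.
have a0 : 0 <= a by [].
nra.
Qed.

Theorem corollary1p7 (R : realType) :
  exists c C : R,
    0 < c /\ 0 < C /\
    forall (F : finFieldType) (q n : nat),
      #|F| = q -> (2 <= n)%N ->
      dTV_Lq_L R F n <=
        C * expR (- c * Num.max (Num.sqrt (n%:R * ln n%:R * ln q%:R)) (ln q%:R)).
Proof.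
(* The distance is at most [4 n^3 exp(- M / 16)], and [n <= 4 M^2].  Half of the
   exponent is kept; the other half absorbs [4 (4 M^2)^3 = 256 M^6], since
   [(M / 32)^6 / 6!] is at most [exp(M / 32)]. *)
exists (1 / 32), (256 * (720 * 32 ^+ 6)); split; first lra.
split; first by rewrite !mulr_gt0 ?exprn_gt0.
move=> F _ n <- n2; set k := ln #|F|%:R; set l := ln n%:R; set M := Num.max _ _.
have l2 : 1 / 2 <= l by exact: ln_ge_half.
have k2 : 1 / 2 <= k by exact: ln_ge_half (card_field_gt1 F).
have n0 : (0 : R) <= n%:R by [].
have nlk : 0 <= n%:R * l * k by apply: mulr_ge0; [apply: mulr_ge0|]; lra.
have M0 : 0 <= M by rewrite le_max sqrtr_ge0.
have nM : n%:R <= 4 * M ^+ 2.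
  have : n%:R * l * k <= M ^+ 2.
    rewrite -(sqr_sqrtr nlk) ler_pXn2r ?nnegrE ?sqrtr_ge0 //.
    by rewrite le_max lexx.
  have : n%:R / 2 <= n%:R * l by rewrite ler_wpM2l //; lra.
  nra.
have E0 : 0 <= expR (- M / 16) := expR_ge0 _.
apply: le_trans (dTV_le_cdf_gap _ _ (ltnW n2)) _.
apply: le_trans (_ : 4 * n%:R ^+ 3 * expR (- M / 16) <= _).
  apply: le_trans (_ : 2 * \sum_(1 <= m < n.+1) (2 * n%:R ^+ 2 * expR (- M / 16)) <= _).
    rewrite ler_pM2l // !big_nat; apply: ler_sum => m /andP[m1 _].
    exact: cdf_gap_bound.
  rewrite sumr_const_nat subn1 /= -(mulr_natl (_ * _) n) le_eqVlt.
  by apply/orP; left; apply/eqP; ring.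
have -> : expR (- M / 16) = expR (- (M / 32)) * expR (- (1 / 32) * M).
  by rewrite -expRD; congr expR; lra.
rewrite mulrA ler_wpM2r ?expR_ge0 // expRN ler_pdivrMr ?expR_gt0 //.
have M32 : 0 <= M / 32 by rewrite divr_ge0.
have H : (M / 32) ^+ 6 / 720 <= expR (M / 32).
  by apply: le_trans (expR_ge1Dxn 5 M32); rewrite !factS fact0 lerDr.
apply: le_trans (_ : 4 * (4 * M ^+ 2) ^+ 3 <= _).
  by rewrite ler_pM2l // lerXn2r ?nnegrE // mulr_ge0 // exprn_ge0.
have -> : 4 * (4 * M ^+ 2) ^+ 3 = 256 * (720 * 32 ^+ 6) * ((M / 32) ^+ 6 / 720).
  by field.
by rewrite ler_wpM2l // !mulr_ge0 // exprn_ge0.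
Qed.
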